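(* Let $r_1,r_2,r_3\ge 0$ with at most one of them equal to zero, and let $P_1,P_2,P_3$ be independent random points with $P_k$ uniform on the circle of radius $r_k$ about $O$. For each $k$, with $\{i,j,k\}=\{1,2,3\}$: $p_k>0$ if and only if $r_k^2<r_i^2+r_j^2$, and $p_k=1/2$ if and only if $r_k=0$. Moreover, at most one of the three inequalities $r_k^2<r_i^2+r_j^2$ ($k=1,2,3$) can fail, except when one radius is zero and the other two are equal, in which case exactly two of them fail.
   Context: $O$ is the origin of $\mathbb{R}^2$. For each $k$, $p_k$ is the probability that $P_1,P_2,P_3$ form a (non-degenerate) triangle whose interior angle at $P_k$ exceeds $\pi/2$. *)

(* Defs.v *)
From HB Require Import structures.
From mathcomp Require Import all_boot all_order all_algebra.
From mathcomp Require Import all_classical all_reals all_analysis.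
Set Implicit Arguments.
Unset Strict Implicit.
Unset Printing Implicit Defensive.
Import Order.TTheory GRing.Theory Num.Theory.
Import numFieldNormedType.Exports.
Local Open Scope classical_set_scope.
Local Open Scope ring_scope.

(* The norm that the library puts on [R * R] is the sup norm, hence the explicit
   Euclidean inner product and norm. *)
Definition dot (R : realType) (u v : R * R) : R := u.1 * v.1 + u.2 * v.2.

Definition enorm (R : realType) (u : R * R) : R := Num.sqrt (dot u u).

Definition collinear (R : realType) (A B C : R * R) : Prop :=
  exists a b c : R, (a, b) != (0, 0) /\
    forall Q : R * R, Q \in [:: A; B; C] -> a * Q.1 + b * Q.2 = c.

Definition nondegenerate_triangle (R : realType) (A B C : R * R) : Prop :=
  ~ collinear A B C.

(* Angle at the first argument; meaningful only when [B != A] and [C != A]. *)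
Definition interior_angle (R : realType) (A B C : R * R) : R :=
  acos (dot (B - A) (C - A) / (enorm (B - A) * enorm (C - A))).

Definition obtuse_at (R : realType) (A B C : R * R) : Prop :=
  nondegenerate_triangle A B C /\ pi / 2 < interior_angle A B C.

Lemma twopi_gt0 (R : realType) : 0 < 2 * pi :> R.
Proof. by rewrite mulr_gt0// pi_gt0. Qed.

Definition circle_point (R : realType) (r t : R) : R * R :=
  (r * cos t, r * sin t).

(* For [r = 0] this is the Dirac mass at the origin. *)
Definition uniform_circle (R : realType) (r : R) : set (R * R) -> \bar R :=
  pushforward (uniform_prob (twopi_gt0 R)) (circle_point r).

Definition has_law (d d' : measure_display) (Omega : measurableType d)
    (T : measurableType d') (R : realType) (P : probability Omega R)
    (X : {RV P >-> T}) (mu : set T -> \bar R) : Prop :=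
  forall A : set T, measurable A -> distribution P X A = mu A.

Definition mutually_independent (d d' : measure_display)
    (Omega : measurableType d) (T : measurableType d') (R : realType)
    (P : probability Omega R) (I : finType) (X : I -> {RV P >-> T}) : Prop :=
  forall (J : {set I}) (A : I -> set T), (forall i, measurable (A i)) ->
    P (\bigcap_(i in [set i | i \in J]) (X i @^-1` A i)) =
    (\prod_(i in J) P (X i @^-1` A i))%E.

(* [{i, j, k} = {1, 2, 3}] *)
Definition distinct3 (i j k : 'I_3) : bool := uniq [:: i; j; k].

Definition prob_obtuse (d : measure_display) (Omega : measurableType d)
    (R : realType) (P : probability Omega R)
    (X : 'I_3 -> {RV P >-> (R * R)%type}) (i j k : 'I_3) : \bar R :=
  P [set w | obtuse_at (X k w) (X i w) (X j w)].

Definition num_failures (R : realType) (r : 'I_3 -> R) : nat :=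
  #|[pred k | [exists i, exists j,
      distinct3 i j k && ~~ (r k ^+ 2 < r i ^+ 2 + r j ^+ 2)]]|.

Definition zero_and_two_equal (R : realType) (r : 'I_3 -> R) : Prop :=
  exists i j k : 'I_3, [/\ distinct3 i j k, r k = 0 & r i = r j].

(* Main.v *)
Require Import Defs.
From HB Require Import structures.
From mathcomp Require Import all_boot all_order all_algebra.
From mathcomp Require Import all_classical all_reals all_analysis.
From mathcomp Require Import measurable_realfun ring lra zify.
Set Implicit Arguments.
Unset Strict Implicit.
Unset Printing Implicit Defensive.
Import Order.TTheory GRing.Theory Num.Theory.
Import numFieldNormedType.Exports.
Local Open Scope classical_set_scope.
Local Open Scope ring_scope.

(** Write [A], [B] for the points on the circles of radii [a], [b] and [C] for
the point on the circle of radius [c] at which the angle is taken.  The triangle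
is obtuse at [C] exactly when [(A - C) . (B - C) < 0] and the cross product of
[A - C] and [B - C] is nonzero ([obtuse_atP]).  By independence and uniqueness of
measures, the probability of this event is the product measure of a set of
triples of angles ([joint_law_circles]).

Positivity.  The identity [2 (A - C) . (B - C) = |A + B - C|^2 + c^2 - a^2 - b^2]
excludes an obtuse angle at [C] when [a^2 + b^2 <= c^2].  When
[c^2 < a^2 + b^2], an explicit obtuse triangle exists: if [C] lies inside one of
the two other circles, the other point is put diametrically opposite to [C]
([obtuse_inside_circle]); otherwise [A] and [B] are put at a right angle and [C]
in the direction of [A + B] ([obtuse_right_angle_chord]).  Being obtuse is an
open condition, hence it has positive probability ([obtuse_angles_gt0]).

The value 1/2.  If [c = 0], the condition is that the cosine of the difference of
two independent uniform angles is negative, an event of probability 1/2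
([obtuse_angles_center]).  If [c > 0], fix [C] and [A].  The condition on [B]
describes a half-plane with normal [A - C]; by rotation invariance of [B] its
probability depends only on the signed distance [C . (A - C) / |A - C|] of its
boundary to the origin.  Replacing [A] by [- A], the two signed distances have a
nonpositive sum ([antipodal_halfplanes]).  So the event and its image under
[(A, B) |-> (- A, - B)], which has the same probability, become disjoint after
this rotation, and both avoid a set of positive measure; hence the probability is
less than 1/2 ([halfplane_set_lt_half]).

Failures.  If the inequalities fail at both [k] and [l], adding them shows that
the third radius is zero and that [r k = r l]. *)

(** * The uniform angle and its rotation invariance *)

Section UniformAngle.
Context {R : realType}.
Local Notation mu := (@lebesgue_measure R).

(** The uniform probability on [[0, 2 * pi]], on the Borel type that carries
the Lebesgue measure. *)
Definition angle_prob : set (measurableTypeR R) -> \bar R :=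
  uniform_prob (twopi_gt0 R).

HB.instance Definition _ := Probability.copy angle_prob (uniform_prob (twopi_gt0 R)).

(** The half-open interval makes the translates by multiples of [2 * pi] disjoint. *)
Lemma angle_probE (A : set R) : measurable A ->
  angle_prob A = (((2 * pi)^-1)%:E * mu (A `&` `]0%R, (2 * pi)%R]))%E.
Proof.
move=> mA; rewrite /angle_prob /uniform_prob integral_uniform_pdf.
rewrite (eq_integral (fun=> ((2 * pi)^-1)%:E)); last first.
  move=> x; rewrite inE => -[_]; rewrite /= in_itv/= => x02.
  by rewrite /uniform_pdf x02 subr0.
rewrite integral_cst//; last exact: measurableI.
congr (_ * _)%E.
have -> : A `&` `[0, 2 * pi]%classic =
    (A `&` `]0, 2 * pi]%classic) `|` (A `&` [set 0]).
  by rewrite -setIUr setUC setU1itv// bnd_simp ltW// twopi_gt0.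
rewrite measureU0//; [exact: measurableI|exact: measurableI|].
apply/eqP; rewrite eq_le measure_ge0 andbT.
rewrite -(lebesgue_measure_set1 (0 : R)) le_measure// inE//.
exact: measurableI.
Qed.

Lemma lebesgue_measure_translate (s : R) (A : set R) : measurable A ->
  mu ((fun x => x + s) @^-1` A) = mu A.
Proof.
move=> mA.
have ms : measurable_fun [set: R] ((fun x => x + s) : R -> measurableTypeR R).
  exact: measurable_funD.
have -> : mu ((fun x => x + s) @^-1` A) = pushforward mu
    (fun x => x + s : measurableTypeR R) A by [].
apply/esym/lebesgue_measure_unique => //= _ [[a b]] _ <-.
rewrite /pushforward/=.
have -> : (fun x : R => x + s) @^-1` `]a, b]%classic = `]a - s, b - s]%classic.
  apply/seteqP; split => x /=; rewrite !in_itv/= => /andP[? ?]; lra.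
rewrite !lebesgue_measure_itv/= !lte_fin ltrD2r; case: ifP => // _.
by rewrite -!EFinB; congr (_%:E); ring.
Qed.


Lemma polar_coordinates (rho u v : R) :
  0 <= rho -> rho ^+ 2 = u ^+ 2 + v ^+ 2 ->
  exists2 psi : R, 0 <= psi <= 2 * pi & u = rho * cos psi /\ v = rho * sin psi.
Proof.
move=> rho_ge0 rho2E; have pi0 := @pi_gt0 R.
have [rho0|rho0] := eqVneq rho 0.
  exists 0; first lra.
  have : u ^+ 2 + v ^+ 2 = 0 by rewrite -rho2E rho0 expr0n.
  move/eqP; rewrite paddr_eq0 ?sqr_ge0// !sqrf_eq0 => /andP[/eqP-> /eqP->].
  by rewrite rho0 !mul0r.
have rho_gt0 : 0 < rho by rewrite lt_def rho0.
have w2 : (u / rho) ^+ 2 = 1 - (v / rho) ^+ 2.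
  have : (u / rho) ^+ 2 + (v / rho) ^+ 2 = rho ^+ 2 / rho ^+ 2.
    by rewrite !expr_div_n -mulrDl rho2E.
  by rewrite divff ?sqrf_eq0//; lra.
have w1 : -1 <= u / rho <= 1.
  by have := sqr_ge0 (v / rho); move: w2; move: (u / rho) => w *;
    apply/andP; split; nra.
have sa : sin (acos (u / rho)) = `|v| / rho.
  rewrite sin_acos// w2 opprB addrC subrK sqrtr_sqr normrM.
  by rewrite [`|rho^-1|]ger0_norm ?invr_ge0.
have : 0 <= acos (u / rho) <= pi by rewrite acos_ge0// acos_lepi.
have ca : cos (acos (u / rho)) = u / rho by rewrite acosK.
move: (acos _) ca sa => a ca sa api.
have a2pi : 0 <= a <= 2 * pi by lra.
have [v0|v0] := leP 0 v.
  exists a => //.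
  by rewrite ca sa ger0_norm//; split; field.
exists (2 * pi - a); first lra.
have -> : 2 * pi - a = - a + pi *+ 2.
  by rewrite mulr2n; ring.
by rewrite cosD2pi sinD2pi cosN sinN ca sa ltr0_norm//; split; field.
Qed.

Lemma measurable_cos_sin :
  measurable_fun [set: R] (fun t : R => (cos t, sin t)).
Proof.
apply: measurable_fun_pair; apply: continuous_measurable_fun.
  exact: continuous_cos.
exact: continuous_sin.
Qed.

(** Rotation invariance of the uniform law on the unit circle. *)
Lemma angle_prob_rotate (s : R) (F : set (R * R)) : measurable F ->
  angle_prob [set t | F (cos (t + s), sin (t + s))] =
  angle_prob [set t | F (cos t, sin t)].
Proof.
move=> mF.
(* Only the cosine and the sine of [s] matter. *)
wlog s02 : s / 0 <= s <= 2 * pi.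
  move=> H; have [||psi psi02] := @polar_coordinates 1 (cos s) (sin s).
  - exact: ler01.
  - by rewrite cos2Dsin2 expr1n.
  rewrite !mul1r => -[cE sE].
  rewrite -(H _ psi02); congr (angle_prob _).
  by apply/seteqP; split => t /=; rewrite !cosD !sinD cE sE.
pose E := [set t : R | F (cos t, sin t)].
have mE : measurable E.
  by rewrite -[E]setTI; exact: measurable_cos_sin.
have mEs (x : R) : measurable [set t : R | E (t + x)].
  have mx : measurable_fun [set: R] (fun t : R => t + x) by exact: measurable_funD.
  by have := mx measurableT E mE; rewrite setTI.
have mEI (x y : R) : measurable (E `&` `]x, y]%classic) by exact: measurableI.
have -> : [set t | F (cos (t + s), sin (t + s))] = [set t : R | E (t + s)] by [].
rewrite -/E !angle_probE//; congr (_ * _)%E.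
have pi0 := @pi_gt0 R.
have -> : [set t : R | E (t + s)] `&` `]0, 2 * pi]%classic =
    (fun t => t + s) @^-1` (E `&` `]s, 2 * pi + s]%classic).
  by apply/seteqP; split=> t /=; rewrite !in_itv/= => -[? ?]; split=> //; lra.
rewrite lebesgue_measure_translate//.
(* The part of the window beyond [2 * pi] is the translate of the part that
   was lost at its start. *)
have -> : E `&` `]s, 2 * pi + s]%classic =
    (E `&` `]s, 2 * pi]%classic) `|` (E `&` `]2 * pi, 2 * pi + s]%classic).
  rewrite -setIUr; congr (_ `&` _); apply/seteqP; split=> t /=; rewrite !in_itv/=.
    by case: (leP t (2 * pi)) => ? ?; [left|right]; lra.
  by case => ?; lra.
have -> : E `&` `]0, 2 * pi]%classic =
    (E `&` `]s, 2 * pi]%classic) `|` (E `&` `]0, s]%classic).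
  rewrite -setIUr; congr (_ `&` _); apply/seteqP; split=> t /=; rewrite !in_itv/=.
    by case: (leP t s) => ? ?; [right|left]; lra.
  by case => ?; lra.
rewrite !measureU//; try exact: mEI; last 2 first.
- by apply/seteqP; split=> t //=; rewrite !in_itv/= => -[[_ ?] [_ ?]]; lra.
- by apply/seteqP; split=> t //=; rewrite !in_itv/= => -[[_ ?] [_ ?]]; lra.
congr (_ + _)%E.
rewrite -[LHS](lebesgue_measure_translate (2 * pi))//; congr (mu _).
apply/seteqP; split=> t /=; rewrite !in_itv/= /E/= mulr_natl cosD2pi sinD2pi.
  by move=> [? ?]; split => //; lra.
by move=> [? ?]; split => //; lra.
Qed.

End UniformAngle.

(** * The joint law of three independent points on circles *)

(** Rectangles form a generating family closed under intersection. *)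
Lemma finite_measure_prod_ext d1 d2 (T1 : measurableType d1)
    (T2 : measurableType d2) (R : realType)
    (m1 m2 : {measure set (T1 * T2) -> \bar R}) :
  (m1 setT < +oo)%E ->
  (forall A B, measurable A -> measurable B -> m1 (A `*` B) = m2 (A `*` B)) ->
  forall D, measurable D -> m1 D = m2 D.
Proof.
move=> m1oo m12 D mD.
pose G : set (set (T1 * T2)) :=
  [set A `*` B | A in @measurable _ T1 & B in @measurable _ T2].
apply: (measure_unique G (fun=> setT)) => //.
- by rewrite measurable_prod_measurableType.
- move=> _ _ [A1 mA1 [B1 mB1 <-]] [A2 mA2 [B2 mB2 <-]].
  rewrite -setXI; exists (A1 `&` A2); first exact: measurableI.
  by exists (B1 `&` B2) => //; exact: measurableI.
- by move=> _; exists setT => //; exists setT => //; rewrite setXTT.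
- by rewrite bigcup_const.
- by move=> _ [A mA [B mB <-]]; exact: m12.
Qed.

Lemma finite_measure_prod3_ext d1 d2 d3 (T1 : measurableType d1)
    (T2 : measurableType d2) (T3 : measurableType d3) (R : realType)
    (m1 m2 : {measure set (T1 * (T2 * T3)) -> \bar R}) :
  (m1 setT < +oo)%E ->
  (forall A B C, measurable A -> measurable B -> measurable C ->
    m1 (A `*` (B `*` C)) = m2 (A `*` (B `*` C))) ->
  forall D, measurable D -> m1 D = m2 D.
Proof.
move=> m1oo m12; apply: finite_measure_prod_ext => // A E mA mE.
(* For a fixed first factor, both measures restrict to finite measures on
   the product of the two others. *)
have mAT : measurable (A `*` [set: T2 * T3]) by exact: measurableX.
have sliceE (m : {measure set (T1 * (T2 * T3)) -> \bar R}) F :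
    m (A `*` F) = pushforward (mrestr m mAT) snd F.
  rewrite /pushforward /mrestr; congr (m _).
  by apply/seteqP; split => -[x y] /= => [[]|[? []]].
rewrite (sliceE m1) (sliceE m2); apply: finite_measure_prod_ext => //.
- rewrite -[X in (X < _)%E](sliceE m1) (le_lt_trans _ m1oo)// le_measure ?inE//.
- by move=> B C mB mC; rewrite -[LHS](sliceE m1) -[RHS](sliceE m2); exact: m12.
Qed.

Lemma distinct3_cover (i j k l : 'I_3) :
  distinct3 i j k -> [|| l == k, l == i | l == j].
Proof.
rewrite /distinct3/= !inE -!val_eqE/=.
by move: (ltn_ord i) (ltn_ord j) (ltn_ord k) (ltn_ord l); lia.
Qed.

Section JointLaw.
Context {R : realType} d (Omega : measurableType d) (P : probability Omega R).

Lemma measurable_circle_point (a : R) :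
  measurable_fun [set: R] (circle_point a).
Proof.
apply: measurable_fun_pair; apply: measurable_funM => //;
  apply: continuous_measurable_fun; [exact: continuous_cos|exact: continuous_sin].
Qed.

Lemma measurable_circle_points (a b c : R) :
  measurable_fun
    [set: measurableTypeR R * (measurableTypeR R * measurableTypeR R)]
    (fun t => (circle_point a t.1,
      (circle_point b t.2.1, circle_point c t.2.2))).
Proof.
pose angles : measurableType _ :=
  (measurableTypeR R * (measurableTypeR R * measurableTypeR R))%type.
have mc (f : angles -> R) s : measurable_fun [set: angles] f ->
    measurable_fun [set: angles] (circle_point s \o f).
  by move=> mf; apply: measurableT_comp mf; exact: measurable_circle_point.
apply: measurable_fun_pair; first exact: mc.
apply: measurable_fun_pair; apply: mc; exact: measurableT_comp.
Qed.

(** The vertex [X k] comes first; integrating over the angles then fixes it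
before the two other points. *)
Lemma joint_law_circles (r : 'I_3 -> R) (X : 'I_3 -> {RV P >-> (R * R)%type})
    (i j k : 'I_3) (S : set ((R * R) * ((R * R) * (R * R)))) :
  mutually_independent X -> (forall l, has_law (X l) (uniform_circle (r l))) ->
  distinct3 i j k -> measurable S ->
  P [set w | S (X k w, (X i w, X j w))] =
  (@angle_prob R \x (@angle_prob R \x @angle_prob R))%E
    [set t | S (circle_point (r k) t.1,
               (circle_point (r i) t.2.1, circle_point (r j) t.2.2))].
Proof.
move=> Xind Xlaw ijk mS.
have mL : measurable_fun [set: Omega] (fun w => (X k w, (X i w, X j w))).
  by apply: measurable_fun_pair => //; exact: measurable_fun_pair.
have mC := measurable_circle_points (r k) (r i) (r j).
set L := (fun w => _) in mL; set L' := (fun t => _) in mC.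
pose M1 := distribution P (mfun_Sub (mem_set mL)).
pose M2 := distribution (@angle_prob R \x (@angle_prob R \x @angle_prob R))%E
  (mfun_Sub (mem_set mC)).
suff : M1 S = M2 S by [].
apply: finite_measure_prod3_ext => //.
  by rewrite [ltLHS]probability_setT ltry.
move=> A B C mA mB mC'; rewrite /M1 /M2 /distribution /pushforward/=.
have law l E : measurable E -> P (X l @^-1` E) =
    angle_prob [set t | E (circle_point (r l) t)].
  by move=> mE; rewrite -[LHS]/(distribution P (X l) E) Xlaw.
have mcE l E : measurable E ->
    measurable ([set t | E (circle_point (r l) t)] : set (measurableTypeR R)).
  move=> mE; rewrite -[X in measurable X]setTI; exact: measurable_circle_point.
pose F l := if l == k then A else if l == i then B else C.
have mF l : measurable (F l) by rewrite /F; case: ifP => // _; case: ifP.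
have FE : F k = A /\ F i = B /\ F j = C.
  move: ijk; rewrite /distinct3/= !inE negb_or => /and3P[/andP[ij ik] jk _].
  by rewrite /F !eqxx (negbTE ik) (negbTE jk) (eq_sym j) (negbTE ij).
transitivity (P (\bigcap_(l in [set l | l \in [set: 'I_3]%SET]) (X l @^-1` F l))).
  congr (P _).
  have [Fk [Fi Fj]] := FE; apply/seteqP; split => w /=.
    move=> [Aw [Bw Cw]] l _.
    by have /or3P[||] := distinct3_cover l ijk => /eqP ->; rewrite ?Fk ?Fi ?Fj.
  move=> Fw; rewrite -Fk -Fi -Fj.
  by split; [|split]; apply: Fw; rewrite /= inE.
rewrite Xind//.
have [ij [jk ik]] : i != j /\ j != k /\ i != k.
  by move: ijk; rewrite /distinct3/= !inE negb_or => /and3P[/andP[-> ->] -> _].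
rewrite (bigD1 k) ?inE//= (bigD1 i) ?inE//= (bigD1 j) ?inE//=; last first.
  by rewrite jk eq_sym ij.
rewrite big1 ?mule1; last first.
  move=> l /andP[/andP[/andP[_ lk] li] lj]; have := distinct3_cover l ijk.
  by rewrite (negbTE lk) (negbTE li) (negbTE lj).
have [-> [-> ->]] := FE; rewrite !law//.
have mBC := measurableX (mcE i _ mB) (mcE j _ mC').
rewrite -[X in (_ * X)%E](product_measure1E (@angle_prob R) (@angle_prob R)
  (mcE i _ mB) (mcE j _ mC')).
pose U2 : probability _ R := (@angle_prob R \x @angle_prob R)%E.
by rewrite -[LHS](product_measure1E (@angle_prob R) U2 (mcE k _ mA) mBC).
Qed.

End JointLaw.

(** * Obtuse angles through dot and cross products *)

Section Obtuse.
Context {R : realType}.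
Implicit Types A B C u v : R * R.

(** The cross product of two plane vectors: twice the signed area they span. *)
Definition cross u v : R := u.1 * v.2 - u.2 * v.1.

(** The identity behind the Cauchy-Schwarz inequality; it keeps the argument
of [acos] in [[-1, 1]]. *)
Lemma dot_cross_sqr u v : dot u v ^+ 2 + cross u v ^+ 2 = dot u u * dot v v.
Proof. by rewrite /dot /cross; ring. Qed.

Lemma dot_ge0 u : 0 <= dot u u.
Proof. by rewrite /dot -!expr2 addr_ge0// sqr_ge0. Qed.

Lemma nondegenerate_triangleP A B C :
  nondegenerate_triangle A B C <-> cross (B - A) (C - A) != 0.
Proof.
case: A => a1 a2; case: B => b1 b2; case: C => c1 c2.
rewrite /nondegenerate_triangle /cross/=; split; last first.
  move=> cr [a [b [c [ab0 abc]]]].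
  have := abc (a1, a2); have := abc (b1, b2); have := abc (c1, c2).
  rewrite !inE !eqxx ?orbT/= => /(_ isT) hC /(_ isT) hB /(_ isT) hA.
  have hb : a * (b1 - a1) + b * (b2 - a2) = 0.
    by rewrite -[RHS](subrr c) -{1}hB -hA; ring.
  have hc : a * (c1 - a1) + b * (c2 - a2) = 0.
    by rewrite -[RHS](subrr c) -{1}hC -hA; ring.
  move: cr hb hc ab0; set x := b1 - a1; set y := b2 - a2; set z := c1 - a1;
    set t := c2 - a2 => cr hb hc; clear -cr hb hc.
  have a0 : a * (x * t - y * z) = 0.
    have -> : a * (x * t - y * z) =
        t * (a * x + b * y) - y * (a * z + b * t) by ring.
    by rewrite hb hc !mulr0 subrr.
  have b0 : b * (x * t - y * z) = 0.
    have -> : b * (x * t - y * z) =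
        x * (a * z + b * t) - z * (a * x + b * y) by ring.
    by rewrite hb hc !mulr0 subrr.
  move: a0 b0 => /eqP; rewrite mulf_eq0 (negbTE cr) orbF => /eqP ->.
  by move=> /eqP; rewrite mulf_eq0 (negbTE cr) orbF => /eqP ->; rewrite eqxx.
move=> ndeg; apply/negP => /eqP cr; apply: ndeg.
have line (p q : R) : (p, q) != (0, 0) ->
    p * (b1 - a1) + q * (b2 - a2) = 0 -> p * (c1 - a1) + q * (c2 - a2) = 0 ->
    collinear (a1, a2) (b1, b2) (c1, c2).
  move=> pq0 pb pc; exists p, q, (p * a1 + q * a2); split => // Q.
  rewrite !inE => /or3P[] /eqP -> //=; lra.
have [b0|b0] := eqVneq (a2 - b2, b1 - a1) (0, 0); last first.
  by apply: (line _ _ b0); [ring|rewrite -[RHS]cr; ring].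
case: b0 => b2E b1E; have {}b2E : b2 - a2 = 0 by rewrite -opprB b2E oppr0.
have [c0|c0] := eqVneq (a2 - c2, c1 - a1) (0, 0); last first.
  by apply: (line _ _ c0); [rewrite b1E b2E !mulr0 addr0|ring].
case: c0 => c2E c1E.
have {}c2E : c2 - a2 = 0 by rewrite -opprB c2E oppr0.
apply: (line 0 1); rewrite ?b2E ?c2E ?mul0r ?mulr0 ?addr0//.
by apply/eqP => -[/eqP]; rewrite oner_eq0.
Qed.

Lemma obtuse_atP A B C :
  obtuse_at A B C <-> dot (B - A) (C - A) < 0 /\ cross (B - A) (C - A) != 0.
Proof.
rewrite /obtuse_at nondegenerate_triangleP /interior_angle /enorm.
move: (B - A) (C - A) => u v.
suff H : cross u v != 0 -> (pi / 2 <
    acos (dot u v / (Num.sqrt (dot u u) * Num.sqrt (dot v v)))) = (dot u v < 0).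
  by split=> [[cr]|[? cr]]; rewrite (H cr).
move=> cr; rewrite -sqrtrM ?dot_ge0// -dot_cross_sqr.
have cr2 : 0 < cross u v ^+ 2 by rewrite lt_def sqrf_eq0 cr sqr_ge0.
set s := dot u v ^+ 2 + cross u v ^+ 2.
have s0 : 0 < s by rewrite ltr_wpDl// sqr_ge0.
have ss0 : 0 < Num.sqrt s by rewrite sqrtr_gt0.
have [x [xE x2]] : exists x : R, dot u v / Num.sqrt s = x /\ x ^+ 2 <= 1.
  exists (dot u v / Num.sqrt s); split => //.
  by rewrite expr_div_n sqr_sqrtr ?(ltW s0)// ler_pdivrMr// mul1r lerDl ltW.
have x1 : -1 <= x <= 1 by clear -x2; apply/andP; split; nra.
have -> : (dot u v < 0) = (x < 0) by rewrite -xE pmulr_llt0// invr_gt0.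
have p0 := @pi_gt0 R.
have aitv : acos x \in `[0, pi] by rewrite in_itv/= acos_ge0// acos_lepi.
have hitv : pi / 2 \in `[0, pi : R] by rewrite in_itv/=; apply/andP; split; lra.
by rewrite xE -(ltr_cos hitv aitv) acosK// cos_pihalf.
Qed.
End Obtuse.

(** * Sections and positivity for products of the uniform angle *)

Lemma measurable_set_ltr d (T : measurableType d) (R : realType) (f g : T -> R) :
  measurable_fun [set: T] f -> measurable_fun [set: T] g ->
  measurable [set x | f x < g x].
Proof.
move=> mf mg; have mfg : measurable_fun [set: T] (fun x => f x < g x).
  by exact: measurable_fun_ltr.
rewrite (_ : [set _ | _] = setT `&` (fun x => f x < g x) @^-1` [set true]).
  exact: mfg.
by rewrite setTI.
Qed.

Section AngleProduct.
Context {R : realType}.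
Local Notation U := (@angle_prob R).
Local Notation angle := (measurableTypeR R).

Lemma angle_prod_xsection_ext (D E : set (angle * angle)) :
  (forall x, U (xsection D x) = U (xsection E x)) ->
  (U \x U)%E D = (U \x U)%E E.
Proof. by move=> DE; apply: eq_integral => x _; exact: DE. Qed.

Lemma angle_prod_ysection_ext (D E : set (angle * angle)) :
  measurable D -> measurable E ->
  (forall y, U (ysection D y) = U (ysection E y)) ->
  (U \x U)%E D = (U \x U)%E E.
Proof.
move=> mD mE DE.
have swap (F : set (angle * angle)) : measurable F ->
    (U \x U)%E F = (U \x^ U)%E F.
  apply: product_measure_unique => A B mA mB; exact: product_measure2E.
rewrite (swap _ mD) (swap _ mE); apply: eq_integral => y _; exact: DE.
Qed.

Lemma angle_prob_gt0 (t : R) (E : set angle) : 0 < t < 2 * pi ->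
  measurable E -> nbhs (t : R) E -> (0 < U E)%E.
Proof.
move=> t02 mE /nbhs_ballP[e /= e0 teE].
have pi0 := @pi_gt0 R.
have [x [x0 xt te]] : exists x, [/\ 0 <= x, x < t & t - e <= x].
  by exists (Num.max 0 (t - e)); rewrite le_max lexx gt_max le_max lexx orbT;
    split => //; lra.
have mI : measurable (`]x, t]%classic : set angle) by exact: measurable_itv.
apply: (@lt_le_trans _ _ (U `]x, t]%classic)); last first.
  apply: le_measure; rewrite ?inE// => y /=; rewrite in_itv/= => xyt.
  by apply: teE; rewrite /ball/= ger0_norm; lra.
rewrite angle_probE//.
have -> : `]x, t]%classic `&` `]0%R, 2 * pi]%classic = `]x, t]%classic :> set R.
  apply/seteqP; split => y /=; first by case.
  by rewrite !in_itv/= => xyt; split => //; lra.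
rewrite lebesgue_measure_itv/= lte_fin xt -EFinB -EFinM lte_fin.
by rewrite mulr_gt0 ?subr_gt0// invr_gt0 twopi_gt0.
Qed.

End AngleProduct.

(** * The bound 1/2 for an obtuse angle off the origin *)

Section HalfBound.
Context {R : realType}.
Local Notation U := (@angle_prob R).
Local Notation angle := (measurableTypeR R).

(** The signed distances [(x - c^2) / |A - C|] and [(- x - c^2) / |A + C|],
where [x = A . C], have a nonpositive sum: no [z] is below the first while [- z]
is below the second.  The hypotheses are multiplied by the distances to avoid a
division by zero. *)
Lemma antipodal_halfplanes (a c x z : R) : 0 < c -> `|x| <= a * c ->
  Num.sqrt (a ^+ 2 + c ^+ 2 - 2 * x) * z < x - c ^+ 2 ->
  Num.sqrt (a ^+ 2 + c ^+ 2 + 2 * x) * - z < - x - c ^+ 2 -> False.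
Proof.
move=> c0.
(* Exchanging [A] and [- A] changes the signs of [x] and [z]. *)
wlog x0 : x z / 0 <= x.
  move=> H xac; have [x0|/ltW x0] := leP 0 x; first exact: H.
  move=> h1 h2; apply: (H (- x) (- z)); rewrite ?oppr_ge0 ?normrN ?mulrN ?opprK//.
  by rewrite -mulrN.
rewrite ger0_norm// => xac.
have N1 : 0 <= a ^+ 2 + c ^+ 2 - 2 * x by have := sqr_ge0 (a - c); nra.
have N2 : 0 <= a ^+ 2 + c ^+ 2 + 2 * x by nra.
move: (sqrtr_ge0 (a ^+ 2 + c ^+ 2 - 2 * x)) (sqr_sqrtr N1).
move: (sqrtr_ge0 (a ^+ 2 + c ^+ 2 + 2 * x)) (sqr_sqrtr N2).
move: (Num.sqrt _) => s2; move: (Num.sqrt _) => s1; move=> s20 s2E s10 s1E.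
rewrite mulrN => h1 h2.
have z0 : 0 < z by rewrite ltNge; apply/negP => z0; nra.
have s1z : 0 <= s1 * z by rewrite mulr_ge0// ltW.
have s2p : 0 < s2 by rewrite lt_def s20 andbT; apply/negP => /eqP s2z; nra.
have lt12 : s1 * (x + c ^+ 2) < s2 * (x - c ^+ 2).
  apply: (@le_lt_trans _ _ (s1 * (s2 * z))).
    by apply: ler_wpM2l => //; lra.
  by rewrite mulrCA ltr_pM2l.
have : (s1 * (x + c ^+ 2)) ^+ 2 < (s2 * (x - c ^+ 2)) ^+ 2.
  by rewrite ltr_pXn2r ?nnegrE// mulr_ge0//; nra.
rewrite !exprMn s1E s2E; apply/negP; rewrite -leNgt -subr_ge0.
have -> : (a ^+ 2 + c ^+ 2 - 2 * x) * (x + c ^+ 2) ^+ 2 -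
  (a ^+ 2 + c ^+ 2 + 2 * x) * (x - c ^+ 2) ^+ 2 =
  4 * x * ((a * c) ^+ 2 - x ^+ 2) by ring.
rewrite mulr_ge0//; first lra.
by rewrite subr_ge0 lerXn2r// nnegrE; lra.
Qed.

(** The pairs (angle of [A], angle of [B]) with [(A - C) . (B - C) < 0], after
[A] is rotated so that [C] has angle zero, and [B] so that its angle is measured
from the direction of [A - C].  The square root is the distance [|A - C|]. *)
Definition halfplane_set (a b c : R) : set (angle * angle) :=
  [set t | Num.sqrt (a ^+ 2 + c ^+ 2 - 2 * (a * c * cos t.1)) * (b * cos t.2) <
    a * c * cos t.1 - c ^+ 2].

Lemma sqr_circle_dist (a c t s : R) :
  (a * cos t - c * cos s) ^+ 2 + (a * sin t - c * sin s) ^+ 2 =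
  a ^+ 2 + c ^+ 2 - 2 * (a * c * cos (t - s)).
Proof.
have -> : a ^+ 2 + c ^+ 2 = a ^+ 2 * (cos t ^+ 2 + sin t ^+ 2) +
    c ^+ 2 * (cos s ^+ 2 + sin s ^+ 2) by rewrite !cos2Dsin2 !mulr1.
by rewrite cosB; ring.
Qed.

Lemma measurable_affine_sqrt d (T : measurableType d) (a c : R) (f : T -> R) :
  measurable_fun [set: T] f ->
  measurable_fun [set: T] (fun t => Num.sqrt (a ^+ 2 + c ^+ 2 - 2 * (a * c * f t))).
Proof.
move=> mf.
have msqrt : measurable_fun [set: R] (@Num.sqrt R).
  by apply: continuous_measurable_fun; exact: sqrt_continuous.
apply: (measurableT_comp msqrt); apply: measurable_funB => //.
by do 2 apply: measurable_funM => //.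
Qed.

Lemma measurable_cos_comp d (T : measurableType d) (f : T -> R) :
  measurable_fun [set: T] f -> measurable_fun [set: T] (fun t => cos (f t)).
Proof.
apply: measurableT_comp; apply: continuous_measurable_fun.
exact: continuous_cos.
Qed.

Lemma measurable_sin_comp d (T : measurableType d) (f : T -> R) :
  measurable_fun [set: T] f -> measurable_fun [set: T] (fun t => sin (f t)).
Proof.
apply: measurableT_comp; apply: continuous_measurable_fun.
exact: continuous_sin.
Qed.

Lemma measurable_halfplane_set_shift (a b c s1 s2 : R) :
  measurable [set t : angle * angle | halfplane_set a b c (t.1 + s1, t.2 + s2)].
Proof.
have m1 : measurable_fun [set: angle * angle] (fun t => cos (t.1 + s1)).
  by apply: measurable_cos_comp; apply: measurable_funD => //; exact: measurable_fst.
have m2 : measurable_fun [set: angle * angle] (fun t => cos (t.2 + s2)).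
  by apply: measurable_cos_comp; apply: measurable_funD => //; exact: measurable_snd.
apply: measurable_set_ltr => /=.
  apply: measurable_funM; first exact: measurable_affine_sqrt.
  exact: measurable_funM.
by apply: measurable_funB => //; exact: measurable_funM.
Qed.

Lemma measurable_halfplane_set (a b c : R) : measurable (halfplane_set a b c).
Proof.
have := measurable_halfplane_set_shift a b c 0 0; congr (measurable _).
by apply/seteqP; split => t; rewrite /halfplane_set/= !addr0.
Qed.

Lemma measurable_planar_ltr (f g : R -> R) :
  measurable_fun [set: R] f -> measurable_fun [set: R] g ->
  measurable [set p : R * R | f p.1 < g p.1].
Proof.
by move=> mf mg; apply: measurable_set_ltr; exact: measurableT_comp.
Qed.

(** The second angle is shifted with the first one fixed, then conversely. *)
Lemma halfplane_set_rotate (a b c s1 s2 : R) :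
  (U \x U)%E [set t | halfplane_set a b c (t.1 + s1, t.2 + s2)] =
  (U \x U)%E (halfplane_set a b c).
Proof.
have m0 := measurable_halfplane_set a b c.
transitivity ((U \x U)%E [set t | halfplane_set a b c (t.1 + s1, t.2)]).
  apply: angle_prod_xsection_ext => x.
  pose y := a * c * cos (x + s1).
  pose F := [set p : R * R |
    Num.sqrt (a ^+ 2 + c ^+ 2 - 2 * y) * (b * p.1) < y - c ^+ 2].
  have mF : measurable F.
    apply: (@measurable_planar_ltr
      (fun u => Num.sqrt (a ^+ 2 + c ^+ 2 - 2 * y) * (b * u)) (cst (y - c ^+ 2))) => //.
    by do 2 apply: measurable_funM => //.
  have := angle_prob_rotate s2 mF; congr (_ = _); congr (angle_prob _);
    by apply/seteqP; split => t; rewrite /xsection/= inE.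
apply: angle_prod_ysection_ext => //.
  have := measurable_halfplane_set_shift a b c s1 0; congr (measurable _).
  by apply/seteqP; split => t; rewrite /halfplane_set/= !addr0.
move=> y.
pose F := [set p : R * R |
  Num.sqrt (a ^+ 2 + c ^+ 2 - 2 * (a * c * p.1)) * (b * cos y) <
    a * c * p.1 - c ^+ 2].
have mF : measurable F.
  apply: (@measurable_planar_ltr
    (fun u => Num.sqrt (a ^+ 2 + c ^+ 2 - 2 * (a * c * u)) * (b * cos y))
    (fun u => a * c * u - c ^+ 2)).
    by apply: measurable_funM => //; exact: measurable_affine_sqrt.
  by apply: measurable_funB => //; exact: measurable_funM.
have := angle_prob_rotate s1 mF; congr (_ = _); congr (angle_prob _);
  by apply/seteqP; split => t; rewrite /ysection/= inE.
Qed.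

(** For a fixed [C], the dot product [(A - C) . B] is [|A - C|] times [b] times the
cosine of the angle from the direction of [A - C] to [B]. *)
Lemma obtuse_dot_halfplane (a b c s : R) :
  (U \x U)%E [set t | dot (circle_point a t.1 - circle_point c s)
                          (circle_point b t.2 - circle_point c s) < 0] =
  (U \x U)%E (halfplane_set a b c).
Proof.
rewrite -(halfplane_set_rotate a b c (- s) 0).
apply: angle_prod_xsection_ext => x.
pose y := a * c * cos (x - s).
set rho := Num.sqrt (a ^+ 2 + c ^+ 2 - 2 * y).
have [||psi _ [uE vE]] := @polar_coordinates R rho
    (a * cos x - c * cos s) (a * sin x - c * sin s).
- exact: sqrtr_ge0.
- by rewrite sqr_circle_dist sqr_sqrtr// -sqr_circle_dist addr_ge0// sqr_ge0.
pose F := [set p : R * R | rho * (b * p.1) < y - c ^+ 2].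
have mF : measurable F.
  apply: (@measurable_planar_ltr (fun u => rho * (b * u)) (cst (y - c ^+ 2))) => //.
  by do 2 apply: measurable_funM => //.
transitivity (U [set t | F (cos (t - psi), sin (t - psi))]).
  congr (angle_prob _); apply/seteqP.
  suff H t : xsection [set t0 : angle * angle |
      dot (circle_point a t0.1 - circle_point c s)
          (circle_point b t0.2 - circle_point c s) < 0] x t =
      F (cos (t - psi), sin (t - psi)) by split => t; rewrite H.
  rewrite /xsection/= inE/= /F/= -subr_lt0; congr (is_true (_ < _)).
  rewrite /dot /circle_point/= uE vE.
  have -> : y - c ^+ 2 = (a * cos x - c * cos s) * (c * cos s) +
      (a * sin x - c * sin s) * (c * sin s).
    rewrite /y cosB -{1}[c ^+ 2]mulr1 -(cos2Dsin2 s); ring.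
  rewrite uE vE cosB; ring.
rewrite angle_prob_rotate//; congr (angle_prob _).
by apply/seteqP; split => t; rewrite /xsection/= inE/= addr0.
Qed.

Lemma nbhs_cos_pihalf_lt (k e : R) : 0 < e ->
  nbhs (pi / 2 : R) [set t : R | k * `|cos t| < e].
Proof.
move=> e0; have : k * `|cos t| @[t --> (pi / 2 : R)] --> k * `|cos (pi / 2 : R)|.
  by apply: cvgMr; apply: cvg_norm; exact: continuous_cos.
by rewrite cos_pihalf normr0 mulr0 => /cvgr_lt; apply.
Qed.

Lemma lte_half_of_double (x y : \bar R) :
  (x + x + y <= 1)%E -> (0 < y)%E -> (x < (1 / 2)%:E)%E.
Proof.
case: x => [x||]; case: y => [y||]; rewrite ?ltNyr//.
by rewrite -!EFinD !lee_fin !lte_fin => ? ?; lra.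
Qed.

(** The half-plane set, its image [E2] under the rotation of both angles by
[pi], and the neighbourhood [Q1 `*` Q2] of [(pi / 2, pi / 2)] are pairwise
disjoint; the first two have the same probability, the last a positive one. *)
Lemma halfplane_set_lt_half (a b c : R) : 0 <= a -> 0 <= b -> 0 < c ->
  ((U \x U)%E (halfplane_set a b c) < (1 / 2)%:E)%E.
Proof.
move=> a0 b0 c0.
pose E2 := [set t : angle * angle | halfplane_set a b c (t.1 + pi, t.2 + pi)].
pose Q1 : set angle := [set t | a * `|cos t| < c / 2].
pose Q2 : set angle := [set t | (a + c) * b * `|cos t| < c ^+ 2 / 2].
have mE1 := measurable_halfplane_set a b c.
have mE2 : measurable E2 by exact: measurable_halfplane_set_shift.
have mQ (k e : R) : measurable ([set t | k * `|cos t| < e] : set angle).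
  apply: measurable_set_ltr => //; apply: measurable_funM => //.
  apply: measurableT_comp => //; exact: measurable_cos_comp.
have mE3 : measurable (Q1 `*` Q2) by apply: measurableX; exact: mQ.
have ac0 : 0 <= a * c by rewrite mulr_ge0// ltW.
(* Disjointness by [antipodal_halfplanes] with [x = a c cos s],
   [z = b cos t]. *)
have E12 : halfplane_set a b c `&` E2 = set0.
  apply/seteqP; split => -[s t] //= -[]; rewrite /E2 /halfplane_set/= !cosDpi => h1 h2.
  apply: (@antipodal_halfplanes a c (a * c * cos s) (b * cos t) c0) => //.
    by rewrite normrM (ger0_norm ac0) ler_piMr// cos_max.
  by move: h2; rewrite !mulrN opprK.
(* On [Q1 `*` Q2] the right-hand side is below [- c^2 / 2], and the left-hand
   side is above it since [|A - C| <= a + c]. *)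
have E3 (s t : R) : Q1 s -> Q2 t -> ~ halfplane_set a b c (s, t).
  rewrite /Q1 /Q2 /halfplane_set/= => hs ht; apply/negP; rewrite -leNgt.
  set u := cos s in hs *; set v := cos t in ht *.
  have u1 : `|u| <= 1 by exact: cos_max.
  have v1 : `|v| <= 1 by exact: cos_max.
  have N0 : 0 <= a ^+ 2 + c ^+ 2 - 2 * (a * c * u).
    have := ler_norm u; have := sqr_ge0 (a - c).
    nra.
  have sqrtN : Num.sqrt (a ^+ 2 + c ^+ 2 - 2 * (a * c * u)) <= a + c.
    rewrite -(@ler_pXn2r _ 2)// ?nnegrE ?sqrtr_ge0//; last lra.
    rewrite sqr_sqrtr//; have := ler_norm (- u); rewrite normrN.
    nra.
  apply: (@le_trans _ _ (- (c ^+ 2 / 2))).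
    have := ler_norm u; nra.
  rewrite lerNl -mulrN; apply: le_trans (ltW ht).
  rewrite -[(a + c) * b * _]mulrA; apply: (@le_trans _ _
    (Num.sqrt (a ^+ 2 + c ^+ 2 - 2 * (a * c * u)) * (b * `|v|))).
    rewrite ler_wpM2l ?sqrtr_ge0// -mulrN ler_wpM2l//.
    by rewrite -normrN ler_norm.
  by rewrite ler_wpM2r// mulr_ge0.
have E123 : (halfplane_set a b c `|` E2) `&` (Q1 `*` Q2) = set0.
  apply/seteqP; split => -[s t] //= -[[|]] h [Q1s Q2t].
    exact: (E3 _ _ Q1s Q2t h).
  apply: (E3 (s + pi) (t + pi)) h; rewrite /Q1 /Q2/= cosDpi normrN//.
have p02 : 0 < (pi / 2 : R) < 2 * pi by have := @pi_gt0 R; lra.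
have Q1_gt0 : (0 < U Q1)%E.
  apply: (angle_prob_gt0 p02) => //; first exact: mQ.
  by apply: nbhs_cos_pihalf_lt; rewrite divr_gt0.
have Q2_gt0 : (0 < U Q2)%E.
  apply: (angle_prob_gt0 p02) => //; first exact: mQ.
  by apply: nbhs_cos_pihalf_lt; rewrite divr_gt0// exprn_gt0.
pose V : probability _ R := (U \x U)%E.
have VE : (V (halfplane_set a b c) + V E2 + V (Q1 `*` Q2) <= 1)%E.
  have mE := measurableU _ _ (measurableU _ _ mE1 mE2) mE3.
  apply: le_trans (probability_le1 V mE); rewrite [leRHS]measureU//.
    by rewrite [X in (_ <= X + _)%E]measureU.
  exact: measurableU.
have V3 : (0 < V (Q1 `*` Q2))%E.
  rewrite [ltRHS](product_measure1E U U); [|exact: mQ|exact: mQ].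
  exact: mule_gt0.
have V2 : V E2 = V (halfplane_set a b c) by exact: halfplane_set_rotate.
rewrite V2 in VE.
rewrite -[X in (X < (1 / 2)%:E)%E]/(V (halfplane_set a b c)).
exact: lte_half_of_double VE V3.
Qed.

End HalfBound.

(** * The set of angle triples with an obtuse angle *)

Section AngleConfigurations.
Context {R : realType}.
Local Notation U := (@angle_prob R).
Local Notation angle := (measurableTypeR R).
Local Notation points := ((R * R) * ((R * R) * (R * R)))%type.

Lemma measurable_dot_cross :
  measurable_fun [set: points] (fun p => dot (p.2.1 - p.1) (p.2.2 - p.1)) /\
  measurable_fun [set: points] (fun p => cross (p.2.1 - p.1) (p.2.2 - p.1)).
Proof.
have m1 : measurable_fun [set: points] (fun p => p.1) by exact: measurable_fst.
have m2 : measurable_fun [set: points] (fun p => p.2.1).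
  by apply: measurableT_comp; [exact: measurable_fst|exact: measurable_snd].
have m3 : measurable_fun [set: points] (fun p => p.2.2).
  by apply: measurableT_comp; exact: measurable_snd.
have mf (f : points -> R * R) : measurable_fun [set: points] f ->
    measurable_fun [set: points] (fun p => (f p).1).
  by move=> ?; apply: measurableT_comp => //; exact: measurable_fst.
have ms (f : points -> R * R) : measurable_fun [set: points] f ->
    measurable_fun [set: points] (fun p => (f p).2).
  by move=> ?; apply: measurableT_comp => //; exact: measurable_snd.
split; rewrite /dot /cross/=.
  by apply: measurable_funD; apply: measurable_funM; apply: measurable_funB;
    (apply: mf || apply: ms).
by apply: measurable_funB; apply: measurable_funM; apply: measurable_funB;
    (apply: mf || apply: ms).
Qed.

Lemma measurable_obtuse_dot :
  measurable [set p : points | dot (p.2.1 - p.1) (p.2.2 - p.1) < 0].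
Proof.
by apply: measurable_set_ltr => //; have [] := measurable_dot_cross.
Qed.

Lemma measurable_obtuse_at :
  measurable [set p : points | obtuse_at p.1 p.2.1 p.2.2].
Proof.
have [md mc] := measurable_dot_cross.
have -> : [set p : points | obtuse_at p.1 p.2.1 p.2.2] =
    [set p | dot (p.2.1 - p.1) (p.2.2 - p.1) < 0] `&`
    ([set p | cross (p.2.1 - p.1) (p.2.2 - p.1) < 0] `|`
     [set p | 0 < cross (p.2.1 - p.1) (p.2.2 - p.1)]).
  apply/seteqP; split => p /=; rewrite obtuse_atP neq_lt.
    by move=> [? /orP].
  by move=> [? /orP].
apply: measurableI; first exact: measurable_obtuse_dot.
by apply: measurableU; exact: measurable_set_ltr.
Qed.

(** The triples of angles (of [C], of [A], of [B]) whose triangle is obtuse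
at [C]. *)
Definition obtuse_angles (a b c : R) : set (angle * (angle * angle)) :=
  [set t | obtuse_at (circle_point c t.1)
             (circle_point a t.2.1) (circle_point b t.2.2)].

(** The same triples without the nondegeneracy condition, which upper bounds
do not need. *)
Definition obtuse_dot_angles (a b c : R) : set (angle * (angle * angle)) :=
  [set t | dot (circle_point a t.2.1 - circle_point c t.1)
             (circle_point b t.2.2 - circle_point c t.1) < 0].

Lemma measurable_obtuse_angles (a b c : R) : measurable (obtuse_angles a b c).
Proof.
rewrite -[X in measurable X]setTI.
exact: (measurable_circle_points c a b measurableT measurable_obtuse_at).
Qed.

Lemma measurable_obtuse_dot_angles (a b c : R) :
  measurable (obtuse_dot_angles a b c).
Proof.
rewrite -[X in measurable X]setTI.
exact: (measurable_circle_points c a b measurableT measurable_obtuse_dot).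
Qed.

Lemma angle_prod_xsection_cst d (T : measurableType d) (V : probability T R)
    (D : set (angle * T)) q :
  (forall x, V (xsection D x) = q) -> (U \x V)%E D = q.
Proof.
move=> Dq; transitivity (\int[U]_x (cst q x))%E.
  by apply: eq_integral => x _; exact: Dq.
by rewrite integral_cst// [X in (_ * X)%E]probability_setT mule1.
Qed.

Lemma obtuse_angles_lt_half (a b c : R) : 0 <= a -> 0 <= b -> 0 < c ->
  ((U \x (U \x U))%E (obtuse_angles a b c) < (1 / 2)%:E)%E.
Proof.
move=> a0 b0 c0.
pose V : probability _ R := (U \x U)%E.
pose W : probability _ R := (U \x V)%E.
apply: (@le_lt_trans _ _ ((U \x (U \x U))%E (obtuse_dot_angles a b c))).
  apply: (le_measure W); rewrite ?inE//.
  - exact: measurable_obtuse_angles.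
  - exact: measurable_obtuse_dot_angles.
  - by move=> t /obtuse_atP[].
rewrite (@angle_prod_xsection_cst _ _ V _ (V (halfplane_set a b c))).
  exact: halfplane_set_lt_half.
move=> x; rewrite -[RHS](obtuse_dot_halfplane a b c x); congr (V _).
by apply/seteqP; split => t; rewrite /xsection/= inE.
Qed.

Lemma angle_prob_cos_eq0 : U [set t | cos t = 0] = 0%E.
Proof.
have p0 := @pi_gt0 R.
have mZ : measurable ([set t | cos t = 0] : set angle).
  have mc : measurable_fun [set: angle] (fun t => cos t) by exact: measurable_cos_comp.
  by have := mc measurableT [set 0] (measurable_set1 0); rewrite setTI.
rewrite angle_probE// countable_lebesgue_measure0 ?mule0//.
apply: finite_set_countable; apply: (@sub_finite_set _ _ [set pi / 2; pi / 2 + pi]);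
  last exact: finite_set2.
move=> t /=; rewrite in_itv/= => -[ct t02].
have cos0 (s : R) : 0 <= s <= pi -> cos s = 0 -> s = pi / 2.
  move=> s0 cs; apply: cos_inj; rewrite ?in_itv//=; last by rewrite cs cos_pihalf.
  by apply/andP; split; lra.
have [tpi|tpi] := leP t pi; [left|right]; first by apply: cos0 => //; lra.
rewrite -[LHS](subrK pi); congr (_ + _); apply: cos0; first lra.
by apply/eqP; rewrite -oppr_eq0 -cosDpi subrK ct.
Qed.

Lemma measurable_left_half_off_axis :
  measurable [set p : R * R | p.1 < 0 /\ p.2 != 0].
Proof.
have -> : [set p : R * R | p.1 < 0 /\ p.2 != 0] =
    [set p | p.1 < 0] `&` ([set p | p.2 < 0] `|` [set p | 0 < p.2]).
  by apply/seteqP; split => p /=; rewrite neq_lt => -[? /orP].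
by apply: measurableI; [|apply: measurableU]; apply: measurable_set_ltr.
Qed.

(** The rotation by [pi] exchanges this event with the one where the cosine
is positive; what remains is null. *)
Lemma angle_prob_cos_lt0 : U [set t | cos t < 0 /\ sin t != 0] = (1 / 2)%:E.
Proof.
have mc : measurable_fun [set: angle] (fun t => cos t) by exact: measurable_cos_comp.
have mF := measurable_left_half_off_axis; set F := (X in measurable X) in mF.
pose N : set angle := [set t | F (cos t, sin t)].
pose P : set angle := [set t | F (cos (t + pi), sin (t + pi))].
pose Zc : set angle := [set t | cos t = 0].
pose Zs : set angle := [set t | cos (t + pi / 2) = 0].
have mcircle (s : R) : measurable ([set t | F (cos (t + s), sin (t + s))] : set angle).
  have m1 : measurable_fun [set: angle] (fun t => t + s) by exact: measurable_funD.
  have m2 : measurable_fun [set: angle] (fun t => (cos (t + s), sin (t + s))).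
    by apply: measurable_fun_pair; [exact: measurable_cos_comp|exact: measurable_sin_comp].
  by have := m2 measurableT F mF; rewrite setTI.
have mP : measurable P by exact: mcircle.
have mN : measurable N.
  by have := mcircle 0; congr (measurable _); apply/seteqP; split => t /=; rewrite addr0.
have m1 : measurable [set p : R * R | p.1 = 0].
  rewrite -[X in measurable X]setTI.
  exact: (@measurable_fst _ _ R R measurableT [set 0] (measurable_set1 0)).
have mZc : measurable Zc.
  by have := mc measurableT [set 0] (measurable_set1 0); rewrite setTI.
have mZs : measurable Zs.
  have m2 : measurable_fun [set: angle] (fun t => cos (t + pi / 2)).
    by apply: measurable_cos_comp; exact: measurable_funD.
  by have := m2 measurableT [set 0] (measurable_set1 0); rewrite setTI.
have Zc0 : U Zc = 0%E by exact: angle_prob_cos_eq0.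
have Zs0 : U Zs = 0%E by rewrite (angle_prob_rotate (pi / 2) m1).
have PN : U P = U N by exact: angle_prob_rotate.
have cover : N `|` P `|` (Zc `|` Zs) = setT.
  apply/seteqP; split => t // _; rewrite /N /P /Zc /Zs /F/= cosDpihalf cosDpi sinDpi.
  have [s0|s0] := eqVneq (sin t) 0; first by right; right; rewrite s0 oppr0.
  by rewrite oppr_lt0 oppr_eq0; case: (ltgtP (cos t) 0) => c0;
    [left; left|left; right|right; left].
have disj : N `&` P = set0.
  apply/seteqP; split => t //=; rewrite /N /P /F/= cosDpi oppr_lt0 => -[[c0 _] [c1 _]].
  by have := lt_trans c0 c1; rewrite ltxx.
have U0 : U (Zc `|` Zs) = 0%E by rewrite measureU0.
have mNP := measurableU _ _ mN mP; have mZ := measurableU _ _ mZc mZs.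
have : (U N + U P)%E = 1%E.
  transitivity (U (N `|` P)); first by rewrite [RHS]measureU.
  transitivity (U (N `|` P `|` (Zc `|` Zs))); first by rewrite [RHS]measureU0.
  by rewrite cover; exact: probability_setT.
rewrite PN -[X in X = (1 / 2)%:E]/(U N).
by case: (U N) => [x||]//; rewrite -EFinD => -[] h; congr (_%:E); lra.
Qed.

Lemma obtuse_angles_center (a b : R) : 0 < a -> 0 < b ->
  (U \x (U \x U))%E (obtuse_angles a b 0) = (1 / 2)%:E.
Proof.
move=> a0 b0.
pose V : probability _ R := (U \x U)%E.
apply: (@angle_prod_xsection_cst _ _ V) => x.
apply: (@angle_prod_xsection_cst _ _ U) => y.
have mF := measurable_left_half_off_axis; set F := (X in measurable X) in mF.
rewrite -angle_prob_cos_lt0 -[RHS](angle_prob_rotate (- y) mF).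
congr (angle_prob _); apply/seteqP.
suff H t : xsection (xsection (obtuse_angles a b 0) x) y t <->
    F (cos (t - y), sin (t - y)) by split => t /H.
rewrite /xsection/= !inE/= inE /obtuse_angles/= obtuse_atP.
rewrite /circle_point !mul0r /F/= cosB sinB.
have -> : dot ((a * cos y, a * sin y) - (0, 0)) ((b * cos t, b * sin t) - (0, 0))
  = a * b * (cos t * cos y + sin t * sin y) by rewrite /dot/= !subr0; ring.
have -> : cross ((a * cos y, a * sin y) - (0, 0)) ((b * cos t, b * sin t) - (0, 0))
  = a * b * (sin t * cos y - cos t * sin y) by rewrite /cross/= !subr0; ring.
by rewrite pmulr_rlt0 ?mulr_gt0// mulf_eq0 negb_or gt_eqF ?mulr_gt0.
Qed.

Lemma angle_prod3_gt0 (x y z : R) (D : set (angle * (angle * angle))) :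
  0 < x < 2 * pi -> 0 < y < 2 * pi -> 0 < z < 2 * pi ->
  measurable D -> nbhs ((x, (y, z)) : R * (R * R)) D ->
  (0 < (U \x (U \x U))%E D)%E.
Proof.
move=> x02 y02 z02 mD /nbhs_ballP[e /= e0 eD].
have mb (t : R) : measurable (ball t e : set angle) by exact: measurable_ball.
have mbb : measurable ((ball y e : set angle) `*` (ball z e : set angle)).
  exact: measurableX.
have b0 (t : R) : 0 < t < 2 * pi -> (0 < U (ball t e))%E.
  by move=> t02; apply: (angle_prob_gt0 t02) => //; exact: nbhsx_ballx.
pose V : probability _ R := (U \x U)%E.
pose W : probability _ R := (U \x V)%E.
apply: (@lt_le_trans _ _ ((U \x (U \x U))%E
    ((ball x e : set angle) `*` ((ball y e : set angle) `*` (ball z e : set angle))))).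
  rewrite [ltRHS](product_measure1E U V)// mule_gt0 ?b0//.
  by rewrite [ltRHS](product_measure1E U U)// mule_gt0 ?b0.
apply: (le_measure W); rewrite ?inE//.
exact: measurableX.
Qed.

Lemma obtuse_angles_gt0_at (a b c x y z : R) :
  0 < x < 2 * pi -> 0 < y < 2 * pi -> 0 < z < 2 * pi ->
  obtuse_at (circle_point c x) (circle_point a y) (circle_point b z) ->
  (0 < (U \x (U \x U))%E (obtuse_angles a b c))%E.
Proof.
move=> x02 y02 z02 /obtuse_atP[d0 c0].
apply: (angle_prod3_gt0 x02 y02 z02); first exact: measurable_obtuse_angles.
pose T := (R * (R * R))%type.
have k1 : continuous (fun t : T => t.1) by move=> t; exact: cvg_fst.
have k2 : continuous (fun t : T => t.2.1).
  by move=> t; apply: (@continuous_comp _ _ _ snd fst); [exact: cvg_snd|exact: cvg_fst].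
have k3 : continuous (fun t : T => t.2.2).
  by move=> t; apply: (@continuous_comp _ _ _ snd snd); exact: cvg_snd.
have kc (f : T -> R) s : continuous f -> continuous (fun t => s * cos (f t)).
  move=> kf t; apply: cvgMr; apply: (continuous_comp (kf t)); exact: continuous_cos.
have ks (f : T -> R) s : continuous f -> continuous (fun t => s * sin (f t)).
  move=> kf t; apply: cvgMr; apply: (continuous_comp (kf t)); exact: continuous_sin.
pose d (t : T) := dot (circle_point a t.2.1 - circle_point c t.1)
                      (circle_point b t.2.2 - circle_point c t.1).
pose e (t : T) := cross (circle_point a t.2.1 - circle_point c t.1)
                        (circle_point b t.2.2 - circle_point c t.1).
have kd : continuous d.
  by move=> t; rewrite /d /dot/=; apply: cvgD; apply: cvgM; apply: cvgB;
    (apply: kc || apply: ks).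
have ke : continuous e.
  by move=> t; rewrite /e /cross/=; apply: cvgB; apply: cvgM; apply: cvgB;
    (apply: kc || apply: ks).
have nd : \forall t \near ((x, (y, z)) : T), d t < 0.
  by apply: (cvgr_lt _ (kd (x, (y, z)))); exact: d0.
have ne : \forall t \near ((x, (y, z)) : T), e t != 0.
  by apply: (cvgr_neq0 _ (ke (x, (y, z)))); exact: c0.
by apply: filterS (filterI nd ne) => t [dt et]; apply/obtuse_atP.
Qed.

End AngleConfigurations.

(** * Positive probability of an obtuse angle *)

Section Positivity.
Context {R : realType}.
Local Notation U := (@angle_prob R).

Lemma polar_coordinates_interior (rho u v : R) :
  0 <= rho -> rho ^+ 2 = u ^+ 2 + v ^+ 2 -> v != 0 ->
  exists2 psi : R, 0 < psi < 2 * pi & u = rho * cos psi /\ v = rho * sin psi.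
Proof.
move=> rho0 rhoE v0; have [psi psi02 [uE vE]] := polar_coordinates rho0 rhoE.
exists psi => //; move: v0; rewrite vE mulf_eq0 negb_or => /andP[_ s0].
have p0 : psi != 0 by apply: contraNneq s0 => ->; rewrite sin0.
have p2 : psi != 2 * pi.
  by apply: contraNneq s0 => ->; rewrite mulr_natl sin2pi.
by move: psi02; rewrite le_eqVlt eq_sym (negbTE p0)/= => /andP[->];
  rewrite le_eqVlt (negbTE p2).
Qed.

Lemma obtuse_atC (A B C : R * R) : obtuse_at C A B -> obtuse_at C B A.
Proof.
rewrite !obtuse_atP => -[d0 c0]; split.
  by move: d0; congr (_ < 0); rewrite /dot; ring.
by move: c0; rewrite -oppr_eq0; congr (_ != 0); rewrite /cross; ring.
Qed.

(** [C] has angle [pi / 2] and [B] is opposite to it.  The height [h] of [A] is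
strictly between [c] and [a], so that [A] lies above [C] and off the line [BC]. *)
Lemma obtuse_inside_circle (a b c : R) : 0 <= b -> 0 <= c -> c < a -> 0 < b + c ->
  exists2 x : R, 0 < x < 2 * pi &
    obtuse_at (circle_point c (pi / 2)) (circle_point a x)
              (circle_point b (pi / 2 + pi)).
Proof.
move=> b0 c0 ca bc; have a0 : 0 < a by exact: le_lt_trans ca.
pose h := (a + c) / 2.
have ah : h < a by rewrite /h; lra.
have ch : c < h by rewrite /h; lra.
have u0 : 0 < a ^+ 2 - h ^+ 2 by nra.
have [|||x x02 [uE vE]] := @polar_coordinates_interior a (Num.sqrt (a ^+ 2 - h ^+ 2)) h.
- exact: ltW.
- by rewrite sqr_sqrtr ?subrK// ltW.
- by rewrite gt_eqF//; lra.
exists x => //; apply/obtuse_atP.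
rewrite /circle_point cosDpi sinDpi cos_pihalf sin_pihalf -uE -vE /dot /cross/=.
have s0 : 0 < Num.sqrt (a ^+ 2 - h ^+ 2) by rewrite sqrtr_gt0.
split; first by nra.
rewrite [X in X != 0](_ : _ = - (Num.sqrt (a ^+ 2 - h ^+ 2) * (b + c))); last ring.
by rewrite oppr_eq0 mulf_neq0// gt_eqF.
Qed.

(** Here [A = (0, a)], [B = (- b, 0)] and [C] points along [A + B], whose norm
[s] exceeds [c].  The triangle is nondegenerate because [s < 2 * c]. *)
Lemma obtuse_right_angle_chord (a b c : R) : 0 < a -> 0 < b -> a <= c -> b <= c ->
  c ^+ 2 < a ^+ 2 + b ^+ 2 ->
  exists2 x : R, 0 < x < 2 * pi &
    obtuse_at (circle_point c x) (circle_point a (pi / 2)) (circle_point b pi).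
Proof.
move=> a0 b0 ac bc cab.
have s2 : 0 < a ^+ 2 + b ^+ 2 by nra.
have [s s0 sE] : exists2 s : R, 0 < s & s ^+ 2 = a ^+ 2 + b ^+ 2.
  by exists (Num.sqrt (a ^+ 2 + b ^+ 2)); rewrite ?sqrtr_gt0// sqr_sqrtr// ltW.
have cs : c < s by nra.
have sc : s < 2 * c by nra.
have [|||x x02 [bE aE]] := @polar_coordinates_interior s (- b) a.
- exact: ltW.
- by rewrite sE sqrrN addrC.
- by rewrite gt_eqF.
exists x => //; apply/obtuse_atP.
rewrite /circle_point cos_pihalf sin_pihalf cospi sinpi /dot /cross/=.
have -> : b = - (s * cos x) by rewrite -bE opprK.
have c0 : 0 < c by lra.
have cosx : cos x != 0.
  by apply/eqP => cx; move: bE; rewrite cx mulr0; lra.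
have sinx : sin x != 0.
  by apply/eqP => sx; move: aE; rewrite sx mulr0; lra.
rewrite aE; split.
  have -> : (s * sin x * 0 - c * cos x) * (- (s * cos x) * -1 - c * cos x) +
    (s * sin x * 1 - c * sin x) * (- (s * cos x) * 0 - c * sin x) =
    c * (c - s) * (cos x ^+ 2 + sin x ^+ 2) by ring.
  by rewrite cos2Dsin2 mulr1 pmulr_rlt0// subr_lt0.
have -> : (s * sin x * 0 - c * cos x) * (- (s * cos x) * 0 - c * sin x) -
    (s * sin x * 1 - c * sin x) * (- (s * cos x) * -1 - c * cos x) =
    s * cos x * sin x * (2 * c - s) by ring.
by rewrite !mulf_neq0// ?gt_eqF// subr_gt0.
Qed.

Lemma obtuse_angles_gt0 (a b c : R) : 0 <= a -> 0 <= b -> 0 <= c ->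
  0 < a + c -> 0 < b + c -> c ^+ 2 < a ^+ 2 + b ^+ 2 ->
  (0 < (U \x (U \x U))%E (obtuse_angles a b c))%E.
Proof.
move=> a0 b0 c0 ac bc cab; have p0 := @pi_gt0 R.
have p1 : 0 < (pi / 2 : R) < 2 * pi by lra.
have p2 : 0 < (pi / 2 + pi : R) < 2 * pi by lra.
have p3 : 0 < (pi : R) < 2 * pi by lra.
have [ca|ac'] := ltP c a.
  have [x x02 /obtuse_angles_gt0_at] := obtuse_inside_circle b0 c0 ca bc.
  exact.
have [cb|bc'] := ltP c b.
  have [x x02 /obtuse_atC /obtuse_angles_gt0_at] := obtuse_inside_circle a0 c0 cb ac.
  exact.
have [|||||x x02 /obtuse_angles_gt0_at] := @obtuse_right_angle_chord a b c; last exact.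
- by nra.
- by nra.
- by [].
- by [].
- by [].
Qed.

Lemma obtuse_angles_eq0 (a b c : R) : a ^+ 2 + b ^+ 2 <= c ^+ 2 ->
  obtuse_angles a b c = set0.
Proof.
move=> abc; apply/seteqP; split => -[x [y z]] //= /obtuse_atP[/= + _].
rewrite /circle_point /dot/=.
have E (r t : R) : r ^+ 2 = (r * cos t) ^+ 2 + (r * sin t) ^+ 2.
  by rewrite !exprMn -mulrDr cos2Dsin2 mulr1.
move: abc; rewrite (E a y) (E b z) (E c x).
move: (a * cos y) (a * sin y) (b * cos z) (b * sin z) (c * cos x) (c * sin x).
move=> a1 a2 b1 b2 c1 c2.
have := sqr_ge0 (a1 + b1 - c1); have := sqr_ge0 (a2 + b2 - c2); nra.
Qed.

End Positivity.

(** * Counting the failing inequalities *)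

Section Failures.
Context {R : realType}.
Implicit Type r : 'I_3 -> R.

(** The inequality at [k] fails, for some labelling of the two other indices. *)
Definition fails r (k : 'I_3) : bool :=
  [exists i, exists j, distinct3 i j k && ~~ (r k ^+ 2 < r i ^+ 2 + r j ^+ 2)].

(** The labelling of the two other indices is immaterial. *)
Lemma failsE r (i j k : 'I_3) : distinct3 i j k ->
  fails r k = (r i ^+ 2 + r j ^+ 2 <= r k ^+ 2).
Proof.
move=> ijk; apply/existsP/idP => [[i' /existsP[j']]|le].
  rewrite -leNgt => /andP[ijk' le].
  have /or3P[/eqP ik|/eqP ii|/eqP ij] := distinct3_cover i ijk'.
  - by move: ijk; rewrite /distinct3/= ik !inE eqxx orbT.
  - have /or3P[/eqP jk|/eqP ji|/eqP jj] := distinct3_cover j ijk'.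
    + by move: ijk; rewrite /distinct3/= jk !inE eqxx andbF.
    + by move: ijk; rewrite /distinct3/= ji ii !inE eqxx.
    + by rewrite ii jj.
  - have /or3P[/eqP jk|/eqP ji|/eqP jj] := distinct3_cover j ijk'.
    + by move: ijk; rewrite /distinct3/= jk !inE eqxx andbF.
    + by rewrite ij ji addrC.
    + by move: ijk; rewrite /distinct3/= jj ij !inE eqxx.
by exists i; apply/existsP; exists j; rewrite ijk -leNgt.
Qed.

Lemma exists_third (k l : 'I_3) : k != l -> exists m, distinct3 k l m.
Proof.
move=> kl; have [m mE] : exists m : 'I_3, nat_of_ord m = (3 - k - l)%N.
  have h : (3 - k - l < 3)%N.
    by move: kl; rewrite -val_eqE/=; move: (ltn_ord k) (ltn_ord l); lia.
  by exists (Ordinal h).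
exists m; rewrite /distinct3/= !inE -!val_eqE/= mE.
by move: kl; rewrite -val_eqE/=; move: (ltn_ord k) (ltn_ord l); lia.
Qed.

Lemma distinct3_rot (i j k : 'I_3) : distinct3 i j k -> distinct3 j k i.
Proof. by rewrite /distinct3 -(rot_uniq 1). Qed.

Lemma distinct3_swap (i j k : 'I_3) : distinct3 i j k -> distinct3 j i k.
Proof.
rewrite /distinct3/= !inE !negb_or => /and3P[/andP[ij ->] -> _].
by rewrite eq_sym ij.
Qed.

Lemma num_failures_le1 r : (forall k, 0 <= r k) -> ~ zero_and_two_equal r ->
  (num_failures r <= 1)%N.
Proof.
move=> r0 nz; apply/card_le1_eqP => l k; rewrite !inE -!/(fails r _) => fl fk.
apply/eqP/negPn/negP => kl; apply: nz.
have [m klm] := exists_third kl.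
move: fk fl; rewrite (failsE r (distinct3_rot klm)).
rewrite (failsE r (distinct3_swap (distinct3_rot (distinct3_rot klm)))).
move=> h1 h2; have m0 : r m = 0.
  by apply/eqP; rewrite -sqrf_eq0 eq_le sqr_ge0 andbT; lra.
have : r k ^+ 2 == r l ^+ 2 by apply/eqP; move: h1 h2; rewrite m0; lra.
by rewrite eqrXn2// => /eqP rkl; exists k, l, m.
Qed.

Lemma num_failures_eq2 r : (forall k l, k != l -> 0 < r k + r l) ->
  zero_and_two_equal r -> num_failures r = 2%N.
Proof.
move=> rp [i [j [k [ijk rk rij]]]].
have [ij [jk ik]] : i != j /\ j != k /\ i != k.
  by move: ijk; rewrite /distinct3/= !inE negb_or => /and3P[/andP[-> ->] -> _].
have ri : 0 < r i by have := rp _ _ ik; rewrite rk addr0.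
rewrite -[RHS](_ : #|pred2 i j| = 2%N); last by rewrite card2 ij.
apply: eq_card => l; rewrite !inE -/(fails r l).
have /or3P[/eqP->|/eqP->|/eqP->] := distinct3_cover l ijk.
- rewrite (failsE r ijk) rk -rij (eq_sym k) (negbTE ik) (eq_sym k) (negbTE jk)/=.
  by apply/negbTE; rewrite -ltNge; nra.
- rewrite eqxx/= (failsE r (distinct3_rot ijk)) rk rij; lra.
- rewrite eqxx orbT (failsE r (distinct3_rot (distinct3_swap ijk))) rk rij; lra.
Qed.

End Failures.

Theorem corollary5p2 (R : realType) (d : measure_display)
    (Omega : measurableType d) (P : probability Omega R)
    (r : 'I_3 -> R) (X : 'I_3 -> {RV P >-> (R * R)%type})
    (r_ge0 : forall k, 0 <= r k)
    (r_zero : (#|[pred k | r k == 0%R]| <= 1)%N)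
    (X_indep : mutually_independent X)
    (X_unif : forall k, has_law (X k) (uniform_circle (r k))) :
  (forall i j k : 'I_3, distinct3 i j k ->
     ((0 < prob_obtuse X i j k)%E <-> r k ^+ 2 < r i ^+ 2 + r j ^+ 2) /\
     (prob_obtuse X i j k = (1 / 2)%:E <-> r k = 0)) /\
  (~ zero_and_two_equal r -> (num_failures r <= 1)%N) /\
  (zero_and_two_equal r -> num_failures r = 2%N).
Proof.
have r_pair k l : k != l -> 0 < r k + r l.
  move=> kl; rewrite lt_def addr_ge0// andbT paddr_eq0//.
  apply: contra kl => /andP[rk rl]; apply/eqP.
  by apply: (card_le1_eqP r_zero); rewrite inE.
split; last first.
  by split; [exact: num_failures_le1|exact: num_failures_eq2].
move=> i j k ijk.
have [ij [jk ik]] : i != j /\ j != k /\ i != k.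
  by move: ijk; rewrite /distinct3/= !inE negb_or => /and3P[/andP[-> ->] -> _].
have -> : prob_obtuse X i j k =
    (@angle_prob R \x (@angle_prob R \x @angle_prob R))%E
      (obtuse_angles (r i) (r j) (r k)).
  exact: (joint_law_circles X_indep X_unif ijk (@measurable_obtuse_at R)).
split; split.
- move=> p0; rewrite ltNge; apply/negP => /obtuse_angles_eq0 E.
  pose W : probability _ R := (@angle_prob R \x (@angle_prob R \x @angle_prob R))%E.
  by move: p0; rewrite E -[ltRHS]/(W set0) measure0 ltxx.
- by move=> h; apply: obtuse_angles_gt0; rewrite ?r_pair.
- move=> pE; apply/eqP; rewrite eq_le r_ge0 andbT leNgt; apply/negP => rk.
  have := obtuse_angles_lt_half (r_ge0 i) (r_ge0 j) rk.
  by rewrite pE ltxx.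
- move=> rk; rewrite rk; apply: obtuse_angles_center.
    by have := r_pair _ _ ik; rewrite rk addr0.
  by have := r_pair _ _ jk; rewrite rk addr0.
Qed.
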